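(* Let $G$ be a finite group and let $H$ be an abelian subgroup of $G$. Then $$ \left\{ \alpha^{[G:H]} \mid \alpha \in S(H) \right\} \subset S(G) \subset S(H), $$ where $[G:H]$ is the index of $H$ in $G$.
   Context: For a finite group $G$ and integers $x_g$ ($g \in G$), let $\Theta_G(x_g) := \det\left( x_{gh^{-1}} \right)_{g,h \in G}$ be the group determinant. Define $S(G) := \{ \Theta_G(x_g) \mid x_g \in \mathbb{Z} \text{ for all } g \in G \} \subset \mathbb{Z}$. *)

(* Defs.v *)
From mathcomp Require Import all_boot all_order all_algebra all_fingroup.
From mathcomp Require Import classical_sets.

Set Implicit Arguments.
Unset Strict Implicit.
Unset Printing Implicit Defensive.

Local Open Scope classical_set_scope.
Local Open Scope ring_scope.

(* Rows and columns are indexed by the library's enumeration of G; the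
   determinant does not depend on that enumeration.  Only the values of x on G
   occur, so x : gT -> R stands for a family (x_g) indexed by the g in G. *)
Definition group_det (R : comNzRingType) (gT : finGroupType) (G : {group gT})
    (x : gT -> R) : R :=
  \det (\matrix_(i < #|G|, j < #|G|)
          x (enum_val i * (enum_val j)^-1)%g).

Definition group_det_values (gT : finGroupType) (G : {group gT}) : set int :=
  [set group_det G x | x in [set: gT -> int]].

(* Main.v *)
Require Import Defs.
From mathcomp Require Import all_boot all_order all_algebra all_fingroup.
From mathcomp Require Import algC classfun character.
From mathcomp Require Import classical_sets.

Set Implicit Arguments.
Unset Strict Implicit.
Unset Printing Implicit Defensive.

Import GRing.Theory Num.Theory.

Local Open Scope classical_set_scope.
Local Open Scope ring_scope.

(** Choose representatives t_i of the right cosets of H in G and order G as the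
    products h t_i.  The group matrix of G then splits into [G:H]^2 blocks
    indexed by H.

    For the first inclusion, extend x from H to G by zero.  Since
    h t_i (h' t_j)^-1 lies in H only when i = j, the matrix is block diagonal
    and each diagonal block is the group matrix of H: this is
    [group_det_extend0].

    For the second inclusion, order G as the products t_i^-1 h^-1 instead.
    Because H is abelian, the block (i, j) is then itself a group matrix of H,
    that is, the action on the group ring of H of some element f_ij of Z[H].
    All blocks lie in one commutative ring isomorphic to Z[H], so the big
    determinant should be the determinant over Z of the element
    y = \det (f_ij) of Z[H], which is the group determinant of H at y.

    This is made precise by the linear characters of H.  As H is abelian there
    are #|H| of them and they are linearly independent
    ([linear_char_basis]), so they diagonalise all the blocks simultaneously.
    Writing f^(chi) for the Fourier coefficient of f, [block_group_det] gives
    that the big determinant is the product over chi of \det (f_ij^(chi)),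
    and [group_det_fourier], which is the case of one block, that the group
    determinant of H at y is the product over chi of y^(chi).  Finally,
    convolution turns into multiplication under each chi, so a determinant of
    Fourier coefficients of integral functions is the Fourier coefficient of an
    integral function that is the same for all chi
    ([fourier_det_integral]); the values of that function are the y_h. *)

(** * Determinants indexed by finite types *)

Section FinDet.
Variable R : comNzRingType.

(** Blocks indexed by pairs are easier to handle than blocks of a matrix with
    sum or product dimensions, hence determinants over any finite type. *)
Definition fin_det (I : finType) (A : I -> I -> R) : R :=
  \det (\matrix_(i < #|I|, j < #|I|) A (enum_val i) (enum_val j)).

Lemma eq_fin_det (I : finType) (A B : I -> I -> R) :
  (forall i j, A i j = B i j) -> fin_det A = fin_det B.
Proof.
by move=> eqAB; congr (\det _); apply/matrixP=> i j; rewrite !mxE eqAB.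
Qed.

(** Rows and columns undergo the same permutation, so the two signs cancel.
    The sizes are kept distinct because they arise as unrelated cardinals. *)
Lemma det_mxsub_inj m n (f : 'I_m -> 'I_n) (A : 'M[R]_n) :
  injective f -> m = n -> \det (mxsub f f A) = \det A.
Proof.
move=> inj_f eq_mn; move: f inj_f A; case: n / eq_mn => f inj_f A.
have ->: mxsub f f A = row_perm (perm inj_f) (col_perm (perm inj_f) A).
  by apply/matrixP=> i j; rewrite !mxE !permE.
rewrite row_permE col_permE !det_mulmx !det_perm odd_permV mulrCA.
by rewrite -signr_addb addbb mulr1.
Qed.

Lemma fin_det_enum (I : finType) n (e : 'I_n -> I) (A : I -> I -> R) :
  injective e -> n = #|I| ->
  \det (\matrix_(i < n, j < n) A (e i) (e j)) = fin_det A.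
Proof.
move=> inj_e eq_n.
rewrite /fin_det -(@det_mxsub_inj n #|I| (fun i => enum_rank (e i))) //.
  by congr (\det _); apply/matrixP=> i j; rewrite !mxE !enum_rankK.
exact: inj_comp enum_rank_inj inj_e.
Qed.

Lemma fin_det_inj (I J : finType) (e : I -> J) (A : J -> J -> R) :
  injective e -> #|I| = #|J| -> fin_det (fun i j => A (e i) (e j)) = fin_det A.
Proof.
move=> inj_e; apply: (@fin_det_enum J #|I| (fun i => e (enum_val i))).
exact: inj_comp inj_e enum_val_inj.
Qed.

Lemma fin_detM (I : finType) (A B : I -> I -> R) :
  fin_det (fun i k => \sum_j A i j * B j k) = fin_det A * fin_det B.
Proof.
rewrite -det_mulmx; congr (\det _); apply/matrixP=> i k; rewrite !mxE.
by rewrite (reindex _ (onW_bij _ (@enum_val_bij I))); apply: eq_bigr => j _;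
  rewrite !mxE.
Qed.

(** Induction on the number of blocks: the first block, put before an
    enumeration of the remaining ones, gives a two-by-two block matrix. *)
Lemma fin_det_blockdiag r n (B : 'I_r -> 'I_n -> 'I_n -> R) :
  fin_det (fun p q : 'I_r * 'I_n => if p.1 == q.1 then B p.1 p.2 q.2 else 0)
  = \prod_i \det (\matrix_(a, b) B i a b).
Proof.
elim: r => [|r IHr] in B *.
  rewrite big_ord0 /fin_det; move: (\matrix_(_, _) _).
  have ->: #|{: 'I_0 * 'I_n}| = 0%N by rewrite card_prod !card_ord.
  by move=> A; rewrite det_mx00.
rewrite big_ord_recl -IHr [X in _ * X]/fin_det -(@det_lblock _ _ _ _ 0).
pose e (k : 'I_(n + #|{: 'I_r * 'I_n}|)) : 'I_r.+1 * 'I_n :=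
  match split k with
  | inl a => (ord0, a)
  | inr k' => (lift ord0 (enum_val k').1, (enum_val k').2)
  end.
have inj_e : injective e.
  move=> k l; rewrite /e -{2}(splitK k) -{2}(splitK l).
  case: (split k) => [a|k']; case: (split l) => [b|l'] //=.
  - by case=> ->.
  - case=> /ord_inj e1 e2; congr (rshift _ _); apply: enum_val_inj.
    by apply: injective_projections.
rewrite -(fin_det_enum _ inj_e); last by rewrite !card_prod !card_ord mulSn.
congr (\det _); apply/matrixP=> k l; rewrite !mxE /e.
case: (split k) => [a|k']; rewrite !mxE; case: (split l) => [b|l'];
  by rewrite !mxE.
Qed.
End FinDet.

(** * Group determinants and linear characters *)

Lemma group_det_reindex (R : comNzRingType) (gT : finGroupType) (G : {group gT})
    (I : finType) (e : I -> gT) (x : gT -> R) :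
  injective e -> (forall i, e i \in G) -> #|I| = #|G| ->
  group_det G x = fin_det (fun i j => x (e i * (e j)^-1)%g).
Proof.
move=> inj_e eG cardI.
pose f (i : 'I_#|I|) := enum_rank_in (group1 G) (e (enum_val i)).
have fK i : enum_val (f i) = e (enum_val i) by rewrite enum_rankK_in.
rewrite /group_det -(@det_mxsub_inj _ _ _ f) //.
  by congr (\det _); apply/matrixP=> i j; rewrite !mxE !fK.
by move=> i j /(congr1 enum_val); rewrite !fK => /inj_e /enum_val_inj.
Qed.

(** An abelian group has as many irreducible characters as elements, all of
    them linear, so they can be indexed by ['I_#|H|] to make the character
    matrix square; the first orthogonality relation exhibits its inverse. *)
Lemma linear_char_basis (gT : finGroupType) (H : {group gT}) :
  abelian H ->
  exists chi : 'I_#|H| -> 'CF(H),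
    (forall l, chi l \is a linear_char)
    /\ (\matrix_(a < #|H|, l < #|H|) chi l (enum_val a)) \in unitmx.
Proof.
move=> cHH.
have eqN : #|H| = Nirr H by rewrite -(card_Iirr_abelian cHH) card_ord.
exists (fun l => 'chi_(cast_ord eqN l)); split.
  by move=> l; apply/char_abelianP.
set C := \matrix_(_, _) _.
pose D := \matrix_(l < #|H|, a < #|H|)
   (#|H|%:R^-1 * 'chi[H]_(cast_ord eqN l) (enum_val a)^-1%g).
suffices /mulmx1_unit[]: D *m C = 1%:M by [].
apply/matrixP=> l l'; rewrite !mxE.
transitivity ((cast_ord eqN l' == cast_ord eqN l)%:R : algC); last first.
  by rewrite eq_sym (inj_eq (@cast_ord_inj _ _ eqN)).
rewrite -first_orthogonality_relation mulr_sumr [RHS]big_enum_val.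
by apply: eq_bigr => a _; rewrite !mxE -mulrA [_ * 'chi__ _]mulrC.
Qed.

Section Fourier.
Variables (gT : finGroupType) (H : {group gT}).

(** The inverse under [phi] makes [fourier phi f] the eigenvalue, on the
    vector of values of [phi], of the matrix with entries f (g * h^-1). *)
Definition fourier (phi : 'CF(H)) (f : gT -> int) : algC :=
  \sum_(k in H) (f k)%:~R * phi k^-1%g.

Definition convolution (f g : gT -> int) (k : gT) : int :=
  \sum_(h in H) f h * g (h^-1 * k)%g.

Lemma fourier1 phi : phi \is a linear_char ->
  fourier phi (fun k => (k == 1%g)%:R) = 1.
Proof.
move=> lin_phi; rewrite /fourier (bigD1 1%g) //= eqxx invg1 lin_char1 // mulr1.
by rewrite big1 ?addr0 // => k /andP[_ /negPf->]; rewrite mul0r.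
Qed.

Lemma fourierD phi f g :
  fourier phi (fun k => f k + g k) = fourier phi f + fourier phi g.
Proof. by rewrite -big_split; apply: eq_bigr => k _; rewrite intrD mulrDl. Qed.

Lemma fourierZ phi c f :
  fourier phi (fun k => c * f k) = c%:~R * fourier phi f.
Proof. by rewrite mulr_sumr; apply: eq_bigr => k _; rewrite intrM mulrA. Qed.

Lemma fourierM phi f g : phi \is a linear_char ->
  fourier phi (convolution f g) = fourier phi f * fourier phi g.
Proof.
move=> lin_phi; rewrite /fourier mulr_suml.
under eq_bigr => k Hk do rewrite rmorph_sum mulr_suml.
rewrite exchange_big; apply: eq_bigr => h Hh; rewrite mulr_sumr.
rewrite (reindex_inj (mulgI h)); apply: eq_big => [k|k].
  by rewrite groupMl.
rewrite groupMl // => Hk; rewrite mulKg rmorphM invMg lin_charM ?groupV //.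
by rewrite [phi k^-1%g * _]mulrC mulrACA.
Qed.

(** The functions phi |-> fourier phi y with y integral contain the constant 1
    and are stable under sums, products and integral multiples, as [fourier] is
    a ring morphism from Z[H] for each linear [phi]; hence they contain the
    Leibniz expansion of the determinant.  The point is that one y serves every
    [phi]. *)
Lemma fourier_det_integral (r : nat) (f : 'I_r -> 'I_r -> gT -> int) :
  exists y : gT -> int, forall phi : 'CF(H), phi \is a linear_char ->
    fourier phi y = \det (\matrix_(i, j) fourier phi (f i j)).
Proof.
pose spectrum (F : 'CF(H) -> algC) := exists y : gT -> int,
  forall phi, phi \is a linear_char -> fourier phi y = F phi.
rewrite -/(spectrum (fun phi => \det (\matrix_(i, j) fourier phi (f i j)))).
have prodP (s : 'S_r) (t : seq 'I_r) :
  spectrum (fun phi => \prod_(i <- t) fourier phi (f i (s i))).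
  elim: t => [|i t [y yE]].
    by exists (fun k => (k == 1%g)%:R) => phi ?; rewrite big_nil fourier1.
  exists (convolution (f i (s i)) y) => phi lin_phi.
  by rewrite big_cons fourierM // yE.
have sumP (t : seq 'S_r) : spectrum (fun phi =>
    \sum_(s <- t) (-1) ^+ s * \prod_i fourier phi (f i (s i))).
  elim: t => [|s t [y yE]].
    exists (fun=> 0) => phi _; rewrite big_nil.
    by rewrite /fourier big1 // => k _; rewrite mul0r.
  have [z zE] := prodP s (index_enum 'I_r).
  exists (fun k => (-1) ^+ s * z k + y k) => phi lin_phi.
  by rewrite big_cons fourierD fourierZ zE // yE // rmorphXn rmorphN1.
have [y yE] := sumP (index_enum {perm 'I_r}).
exists y => phi lin_phi; rewrite yE //; apply: eq_bigr => s _.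
by congr (_ * _); apply: eq_bigr => i _; rewrite mxE.
Qed.

(** Commuting blocks: if M is the matrix on the left, C the character matrix
    and P the block diagonal matrix with all blocks equal to C, then
    M P = P N, where N collects the eigenvalues of the blocks.  Grouping the
    indices of N by character rather than by block makes it block diagonal,
    and det P is a power of det C, so it can be cancelled. *)
Lemma block_group_det (r : nat) (f : 'I_r -> 'I_r -> gT -> int)
    (chi : 'I_#|H| -> 'CF(H)) :
  (forall l, chi l \is a linear_char) ->
  \matrix_(a < #|H|, l < #|H|) chi l (enum_val a) \in unitmx ->
  fin_det (fun p q : 'I_r * 'I_#|H| =>
     (f p.1 q.1 (enum_val p.2 * (enum_val q.2)^-1)%g)%:~R : algC)
  = \prod_l \det (\matrix_(i, j) fourier (chi l) (f i j)).
Proof.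
set C := \matrix_(_, _) _ => lin_chi unitC.
pose P (p q : 'I_r * 'I_#|H|) : algC := if p.1 == q.1 then C p.2 q.2 else 0.
have detP : fin_det P != 0.
  rewrite (fin_det_blockdiag (fun=> C)); apply/prodf_neq0 => i _.
  rewrite -unitfE; suffices ->: \matrix_(a, b) C a b = C by rewrite -unitmxE.
  by apply/matrixP=> a b; rewrite mxE.
pose N (p q : 'I_r * 'I_#|H|) : algC :=
  if p.2 == q.2 then fourier (chi p.2) (f p.1 q.1) else 0.
have detN : fin_det N = \prod_l \det (\matrix_(i, j) fourier (chi l) (f i j)).
  rewrite -(fin_det_blockdiag (fun l i j => fourier (chi l) (f i j))).
  pose swap (p : 'I_r * 'I_#|H|) := (p.2, p.1).
  rewrite -(@fin_det_inj _ _ _ swap) //.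
    by move=> [i a] [j b] [-> ->].
  by rewrite !card_prod mulnC.
rewrite -detN; apply: (mulIf detP); rewrite [RHS]mulrC -!fin_detM.
apply: eq_fin_det => -[i a] [j l] /=.
(* Both entries equal this: on the left chi l is an eigenvector of the block
   (i, j), on the right the sum has a single nonzero term. *)
transitivity (fourier (chi l) (f i j) * chi l (enum_val a)).
  rewrite -(pair_bigA _ (fun j' b =>
    (f i j' (enum_val a * (enum_val b)^-1)%g)%:~R * P (j', b) (j, l))) /=.
  rewrite (bigD1 j) //= [X in _ + X]big1 ?addr0 => [|j' /negPf neq_j]; last first.
    by rewrite big1 // => b _; rewrite /P /= neq_j mulr0.
  rewrite /P /= eqxx /fourier mulr_suml.
  under eq_bigr => b _ do rewrite mxE.
  rewrite -(big_enum_val (A := mem H) (fun h =>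
    (f i j (enum_val a * h^-1)%g)%:~R * chi l h)) /=.
  have Ha := enum_valP a.
  (* The new index k is the quotient h_a * h^-1. *)
  rewrite (reindex_inj (inj_comp (mulIg (enum_val a)) invg_inj)) /=.
  apply: eq_big => [k|k]; first by rewrite groupMr // groupV.
  rewrite groupMr // groupV => Hk.
  by rewrite invMg invgK mulKVg lin_charM ?groupV // mulrA.
rewrite -(pair_bigA _ (fun j' l' => P (i, a) (j', l') * N (j', l') (j, l))) /=.
rewrite (bigD1 i) //= [X in _ + X]big1 ?addr0 => [|j' /negPf neq_j]; last first.
  by rewrite big1 // => b _; rewrite /P /= eq_sym neq_j mul0r.
rewrite (bigD1 l) //= [X in _ + X]big1 ?addr0 => [|l' /negPf neq_l]; last first.
  by rewrite /N /= neq_l mulr0.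
by rewrite /P /N /= !eqxx mxE mulrC.
Qed.

(** Dedekind's factorisation of the group determinant of an abelian group,
    obtained as the case of a single block. *)
Lemma group_det_fourier (y : gT -> int) (chi : 'I_#|H| -> 'CF(H)) :
  (forall l, chi l \is a linear_char) ->
  \matrix_(a < #|H|, l < #|H|) chi l (enum_val a) \in unitmx ->
  (group_det H y)%:~R = \prod_l fourier (chi l) y.
Proof.
move=> lin_chi unitC.
transitivity (\prod_l \det (\matrix_(i < 1, j < 1) fourier (chi l) y)); last first.
  by apply: eq_bigr => l _; rewrite det_mx11 mxE.
rewrite -(block_group_det (fun _ _ : 'I_1 => y)) // -det_map_mx.
rewrite -(@fin_det_enum _ _ _ (fun a : 'I_#|H| => (ord0 : 'I_1, a))) /=.
- by congr (\det _); apply/matrixP=> a b; rewrite !mxE.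
- by move=> a b [].
- by rewrite card_prod !card_ord mul1n.
Qed.
End Fourier.

(** * Coset decomposition and the two inclusions *)

Lemma right_transversal (gT : finGroupType) (G H : {group gT}) :
  H \subset G ->
  exists t : 'I_#|G : H|%g -> gT, (forall i, t i \in G) /\
    (forall i j, (t i * (t j)^-1)%g \in H -> i = j).
Proof.
move=> sHG; pose C (i : 'I_#|G : H|%g) := enum_val (A := mem (rcosets H G)) i.
pose t i := repr (C i).
have tE i : exists2 g, g \in G & C i = (H :* g)%g.
  by apply/rcosetsP; exact: enum_valP.
have cosetE i : (H :* t i)%g = C i.
  by rewrite /t; have [g _ ->] := tE i; rewrite rcoset_repr.
exists t; split=> [i|i j].
  have [g Gg Eg] := tE i.
  have: t i \in (H :* g)%g by rewrite -Eg -cosetE rcoset_refl.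
  by case/rcosetP=> h Hh ->; rewrite groupM // (fintype.subsetP sHG).
rewrite -mem_rcoset => /rcoset_eqP; rewrite !cosetE; exact: enum_val_inj.
Qed.

Section Inclusions.
Variables (gT : finGroupType) (G H : {group gT}).
Hypothesis sHG : H \subset G.

Lemma group_det_coset_pairs (t : 'I_#|G : H|%g -> gT) :
  (forall i, t i \in G) ->
  (forall i j, (t i * (t j)^-1)%g \in H -> i = j) ->
  let e (p : 'I_#|G : H|%g * 'I_#|H|) := (enum_val p.2 * t p.1)%g in
  [/\ injective e, forall p, e p \in G
    & #|{: 'I_#|G : H|%g * 'I_#|H|}| = #|G|].
Proof.
move=> tG t_inj e; split; last by rewrite card_prod !card_ord mulnC Lagrange.
- move=> [i a] [j b]; rewrite /e /= => eq_e.
  have eq_ij : i = j.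
    apply: t_inj.
    have ->: (t i * (t j)^-1 = (enum_val a)^-1 * enum_val b)%g.
      by apply: (canRL (mulKg _)); rewrite mulgA eq_e mulgK.
    by rewrite groupM ?groupV ?enum_valP.
  rewrite eq_ij in eq_e *; congr (_, _); apply: enum_val_inj.
  exact: mulIg eq_e.
- by move=> p; rewrite /e groupM // (fintype.subsetP sHG) // enum_valP.
Qed.

(** The zero pattern of the extended function sees exactly which pairs of
    elements lie in the same right coset. *)
Lemma group_det_extend0 (R : comNzRingType) (x : gT -> R) :
  group_det G (fun g => if g \in H then x g else 0)
  = group_det H x ^+ #|G : H|%g.
Proof.
have [t [tG t_inj]] := right_transversal sHG.
have [e_inj eG cardE] := group_det_coset_pairs tG t_inj.
rewrite (group_det_reindex _ e_inj eG cardE).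
transitivity (\prod_(i < #|G : H|%g) group_det H x); last first.
  by rewrite prodr_const card_ord.
rewrite /group_det -(fin_det_blockdiag
  (fun _ a b => x (enum_val a * (enum_val b)^-1)%g)).
apply: eq_fin_det => -[i a] [j b] /=.
rewrite invMg mulgA -(mulgA _ (t i)).
rewrite groupMr ?groupV ?enum_valP // groupMl ?enum_valP //.
case: eqP => [->|neq_ij]; first by rewrite mulgV group1 mulg1.
by case: ifP => // /t_inj.
Qed.

(** Expanding both sides over the linear characters of H reduces the claim to
    [fourier_det_integral]. *)
Lemma group_det_abelian_subgroup (x : gT -> int) :
  abelian H -> exists y : gT -> int, group_det H y = group_det G x.
Proof.
move=> cHH.
have [t [tG t_inj]] := right_transversal sHG.
pose e p : gT := (enum_val (A := mem H) p.2 * t p.1)%g.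
have [e_inj eG cardE] := group_det_coset_pairs tG t_inj.
have [chi [lin_chi unitC]] := linear_char_basis cHH.
(* Enumerating G by the inverses of the h_a * t_i gives the entries
   x (t_i^-1 * h_a^-1 * h_b * t_j), and h_a^-1 * h_b is the inverse of
   h_a * h_b^-1 because H is abelian. *)
pose f i j k := x ((t i)^-1 * k^-1 * t j)%g.
have [y yE] := fourier_det_integral H f.
exists y; apply: (@intr_inj algC).
rewrite (group_det_fourier _ lin_chi unitC).
under eq_bigr => l _ do rewrite yE //.
rewrite -(block_group_det f lin_chi unitC).
rewrite (@group_det_reindex _ _ G _ (fun p => (e p)^-1%g)) //; first last.
- by move=> p; rewrite groupV eG.
- exact: inj_comp invg_inj e_inj.
rewrite /fin_det -det_map_mx; congr (\det _); apply/matrixP=> p q; rewrite !mxE.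
rewrite /f !invMg !invgK !mulgA; congr ((x _)%:~R).
rewrite -!mulgA; congr (_ * _)%g; rewrite !mulgA; congr (_ * _)%g.
by apply: (centsP cHH); rewrite ?groupV enum_valP.
Qed.
End Inclusions.

Theorem theorem1p4 (gT : finGroupType) (G H : {group gT})
    (sHG : H \subset G) (cHH : abelian H) :
  [set alpha ^+ #|G : H|%g | alpha in group_det_values H] `<=` group_det_values G
  /\ group_det_values G `<=` group_det_values H.
Proof.
split=> [_ [_ [x _ <-] <-]|_ [x _ <-]].
  by exists (fun g => if g \in H then x g else 0) => //; apply: group_det_extend0.
by have [y yE] := group_det_abelian_subgroup sHG x cHH; exists y.
Qed.
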